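(* Let $(\mathcal S,\mathcal A,J,P,c)$ be an SSP instance satisfying: (i) in the support graph there is a directed path from every state vertex to the target state vertex, and (ii) there is no $x\in\mathbb R^m$ with $x\ge0$, $(J-P)^Tx=0$, $c^Tx<0$. For $i=1,\dots,n$ let $V^*(i):=\min_{\Pi\in\mathcal P}c^T\sum_{k\ge0}x_k^\Pi$ with initial distribution $y_0^\Pi=e_i$, where $\mathcal P$ is the set of proper policies. Let $M\in\mathbb R^n$ satisfy $M(i)\ge V^*(i)$ for all $i=1,\dots,n$, and define $V_1(i):=M(i)$ and, for $k\ge2$, $$V_k(i):=\min\Big\{V_{k-1}(i),\ \min_{a\in\mathcal A(i)}\Big(c(a)+\sum_{j=1}^n p(j|a)V_{k-1}(j)\Big)\Big\}.$$ Then $V^*(i)=\lim_{K\to+\infty}V_K(i)$ for all $i=1,\dots,n$.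
   Context: An SSP instance is a tuple $(\mathcal S,\mathcal A,J,P,c)$ with states $\mathcal S=\{0,\dots,n\}$ (target $0$), actions $\mathcal A=\{0,\dots,m\}$ (action $0$ unique at state $0$, leading to $0$ with probability 1), $J\in\{0,1\}^{m\times n}$ with $J(a,s)=1$ iff action $a$ is available in state $s$ (each action $a\ge1$ available in exactly one state; $\mathcal A(s)$ the actions available in $s$), $P$ an $m\times n$ row-substochastic matrix with $P(a,s)=p(s|a)$ the probability of moving to $s\in\{1,\dots,n\}$ after action $a$ and $p(0|a)=1-\sum_sP(a,s)$, and $c\in\mathbb R^m$. The support graph is the directed bipartite graph on state vertices and action vertices with arcs $(s,a)$ for $s\ge1,a\in\mathcal A(s)$, arcs $(a,s)$ whenever $a\ge1$ and $p(s|a)>0$, and arcs between target state and target action in both directions. A policy chooses at each time, possibly depending on the history, a probability distribution over the actions available at the current state. For initial state distribution $y_0^\Pi$, $x_k^\Pi\in\mathbb R^m_{\ge0}$ is the vector of probabilities of taking each action at time $k$. A policy is $s$-proper if $\sum_kx_k^\Pi$ is finite when $y_0^\Pi=e_s$, and proper if it is $s$-proper for all $s=1,\dots,n$. *)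

(* Defs.v *)
From HB Require Import structures.
From mathcomp Require Import all_boot all_order all_algebra.
From mathcomp Require Import all_classical all_reals all_analysis.

Set Implicit Arguments.
Unset Strict Implicit.
Unset Printing Implicit Defensive.

Import Order.TTheory GRing.Theory Num.Theory.
Import numFieldNormedType.Exports.

Local Open Scope classical_set_scope.
Local Open Scope ring_scope.

(* The nontarget states 1, ..., n and actions 1, ..., m are indexed by 'I_n   *)
(* and 'I_m, so that J, P, c and the occupation vectors are genuine matrices. *)
Record ssp (R : realType) (n m : nat) := SSP {
  ssp_J : 'M[R]_(m, n);
  ssp_P : 'M[R]_(m, n);
  ssp_c : 'cV[R]_m;
  ssp_J01 : forall a s, ssp_J a s = 0 \/ ssp_J a s = 1;
  ssp_J_unique : forall a, exists! s, ssp_J a s = 1;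
  ssp_P_ge0 : forall a s, 0 <= ssp_P a s;
  ssp_P_substoch : forall a, \sum_s ssp_P a s <= 1
}.

(* [None] is the target state, resp. the target action. *)
Notation state n := (option 'I_n).
Notation action m := (option 'I_m).

Section SSP.
Variables (R : realType) (n m : nat) (I : ssp R n m).

Local Notation J := (ssp_J I).
Local Notation P := (ssp_P I).
Local Notation c := (ssp_c I).

Definition available (s : state n) (a : action m) : bool :=
  match s, a with
  | None, None => true
  | Some s', Some a' => J a' s' == 1
  | _, _ => false
  end.

(* [trans a s] is p(s | a). *)
Definition trans (a : action m) (s : state n) : R :=
  match a, s with
  | None, None => 1
  | None, Some _ => 0
  | Some a', Some s' => P a' s'
  | Some a', None => 1 - \sum_j P a' j
  end.

Definition support_arc (u v : state n + action m) : bool :=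
  match u, v with
  | inl s, inr a => available s a
  | inr a, inl s => 0 < trans a s
  | _, _ => false
  end.

Definition target_reachable : Prop :=
  forall s : state n, connect support_arc (inl s) (inl None).

Definition no_negative_transition_cycle : Prop :=
  ~ exists x : 'cV[R]_m,
      [/\ forall a, 0 <= x a 0, (J - P)^T *m x = 0 & (c^T *m x) 0 0 < 0].

(* A history lists the past (state, action) pairs, the most recent one first; *)
(* [Pi h s a] is the probability of choosing [a] when the current state is    *)
(* [s] and the past is [h].                                                   *)
Definition history := seq (state n * action m).

Record policy := Policy {
  policy_fun :> history -> state n -> action m -> R;
  policy_ge0 : forall h s a, 0 <= policy_fun h s a;
  policy_sum1 : forall h s, \sum_a policy_fun h s a = 1;
  policy_available : forall h s a, policy_fun h s a != 0 -> available s a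
}.

(* Probability that the past is [h] and the current state, at time [size h],  *)
(* is [s], for the initial distribution [y0].                                 *)
Fixpoint history_prob (Pi : policy) (y0 : state n -> R) (h : history)
    (s : state n) : R :=
  match h with
  | [::] => y0 s
  | (s', a) :: h' => history_prob Pi y0 h' s' * Pi h' s' a * trans a s
  end.

Definition action_prob (Pi : policy) (y0 : state n -> R) (k : nat) : 'cV[R]_m :=
  \col_a \sum_(h : k.-tuple (state n * action m)) \sum_s
           history_prob Pi y0 h s * Pi h s (Some a).

Definition point_mass (i : 'I_n) (s : state n) : R := (s == Some i)%:R.

Definition proper_from (Pi : policy) (i : 'I_n) : Prop :=
  forall a, cvgn (series (fun k => action_prob Pi (point_mass i) k a 0)).

Definition proper (Pi : policy) : Prop := forall i, proper_from Pi i.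

Definition policy_cost (Pi : policy) (i : 'I_n) : R :=
  (c^T *m \col_a limn (series (fun k => action_prob Pi (point_mass i) k a 0)))
    0 0.

Definition proper_costs (i : 'I_n) : set R :=
  [set policy_cost Pi i | Pi in [set Pi | proper Pi]].

Definition Vstar (i : 'I_n) : R := inf (proper_costs i).

(* V_(k-1)(i) is the default value of the iterated minimum, which is thus the *)
(* minimum of V_(k-1)(i) and of the one-step values of the actions in A(i).   *)
Definition vi_step (V : 'cV[R]_n) : 'cV[R]_n :=
  \col_i \big[Num.min/V i 0]_(a | J a i == 1) (c a 0 + \sum_j P a j * V j 0).

(* The sequence starts at k = 1; the value at k = 0 is irrelevant. *)
Definition value_iteration (M : 'cV[R]_n) (k : nat) : 'cV[R]_n :=
  iter k.-1 vi_step M.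

End SSP.

Definition is_minimum (R : realType) (A : set R) (v : R) : Prop :=
  A v /\ lbound A v.

(* Main.v *)
(** Among the deterministic stationary policies [f] for which [1 - P_f] is
    invertible (there is one, following shortest paths to the target), take one
    minimising the sum of the entries of its value [V = (1 - P_f)^-1 c_f].  Then
    [V] is feasible for the dual program [(J - P) V <= c].  Otherwise, switch [f]
    at one state to an action violating its constraint.  If the new matrix is
    still invertible, its inverse is nonnegative and the value strictly
    decreases.  If it is singular, it has a nonnegative invariant row vector,
    which charges the switched state, and which gives an [x >= 0] with
    [(J - P)^T x = 0] and [c^T x < 0].
    By weak duality a dual feasible vector is a lower bound for the cost of every
    proper policy, so [V = V*] and the minimum is attained at [f].  Value
    iteration decreases, stays above the feasible [V*], and its limit is again
    dual feasible, hence at most [V*]. *)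

Require Import Defs.
From HB Require Import structures.
From mathcomp Require Import all_boot all_order all_algebra.
From mathcomp Require Import all_classical all_reals all_analysis.
From mathcomp Require Import ring lra.

Import Order.TTheory GRing.Theory Num.Theory.
Import numFieldNormedType.Exports.

Local Open Scope classical_set_scope.
Local Open Scope ring_scope.

Set Implicit Arguments.
Unset Strict Implicit.
Unset Printing Implicit Defensive.

(** * Finite sums: limits and sums over tuples *)

Section BigSums.
Variable R : realType.

Lemma cvgn_sum (I : finType) (u : I -> nat -> R) (l : I -> R) :
  (forall i, u i @ \oo --> l i) ->
  (fun k => \sum_i u i k) @ \oo --> \sum_i l i.
Proof.
by move=> ul; apply: cvg_big => [|i _]; [exact: add_continuous|exact: ul].
Qed.

Lemma sum_option (T : finType) (F : option T -> R) :
  \sum_x F x = F None + \sum_x F (Some x).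
Proof.
rewrite (bigD1 None) //=; congr (_ + _).
rewrite (reindex_omap Some id) => [|[x|]] //=.
by apply: eq_bigl => x; rewrite eqxx.
Qed.

Lemma sum_tuple0 (T : finType) (F : 0.-tuple T -> R) :
  \sum_t F t = F [tuple].
Proof. by rewrite (big_pred1 [tuple]) // => t; exact/esym/eqP/tuple0. Qed.

(** The head that is split off is, in a history, the most recent state-action pair. *)
Lemma sum_tupleS (T : finType) (k : nat) (F : k.+1.-tuple T -> R) :
  \sum_t F t = \sum_(t : k.-tuple T) \sum_x F [tuple of x :: t].
Proof.
rewrite pair_big /=.
rewrite (reindex (fun p : k.-tuple T * T => [tuple of p.2 :: p.1])) //=.
exists (fun t : k.+1.-tuple T => ([tuple of behead t], thead t)) => [[t x] _|t _] /=.
  by rewrite theadE; congr (_, _); apply: val_inj.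
by rewrite [RHS]tuple_eta.
Qed.

End BigSums.

(** * Powers of a substochastic matrix and the inverse of [1 - Q] *)

Section Substochastic.
Variables (R : realType) (n : nat) (Q : 'M[R]_n).
Hypothesis Q_ge0 : forall s t, 0 <= Q s t.
Hypothesis Q_sum : forall s, \sum_t Q s t <= 1.

Lemma substoch_expr_ge0 k s t : 0 <= (Q ^+ k) s t.
Proof.
elim: k s t => [|k IH] s t; first by rewrite expr0 mxE ler0n.
by rewrite exprS mxE sumr_ge0 // => r _; rewrite mulr_ge0.
Qed.

Lemma substoch_expr_sum k s : \sum_t (Q ^+ k) s t <= 1.
Proof.
elim: k s => [|k IH] s.
  rewrite expr0 (bigD1 s) //= mxE eqxx big1 ?addr0 // => t ts.
  by rewrite mxE eq_sym (negbTE ts).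
under eq_bigr do rewrite exprS mxE.
rewrite exchange_big /=; apply: le_trans (Q_sum s).
by apply: ler_sum => r _; rewrite -mulr_sumr ler_piMr.
Qed.

Lemma substoch_expr_le1 k s t : (Q ^+ k) s t <= 1.
Proof.
apply: le_trans (substoch_expr_sum k s); rewrite (bigD1 t) //= lerDl.
by apply: sumr_ge0 => r _; exact: substoch_expr_ge0.
Qed.

Hypothesis Q_unit : 1%:M - Q \in unitmx.

Lemma substoch_geometric k :
  \sum_(l < k) Q ^+ l = invmx (1%:M - Q) *m (1%:M - Q ^+ k).
Proof.
rewrite -[LHS](mulKmx Q_unit); congr (_ *m _).
by have /(congr1 -%R) := subrX1 Q k; rewrite -mulNr !opprB => ->.
Qed.

(** The partial sums are nondecreasing and equal [(1 - Q)^-1 (1 - Q^k)], where the entries of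
    [1 - Q^k] have absolute value at most 2. *)
Lemma substoch_series_is_cvg s t : cvgn (series (fun k => (Q ^+ k) s t)).
Proof.
have E k : series (fun k => (Q ^+ k) s t) k =
    (invmx (1%:M - Q) *m (1%:M - Q ^+ k)) s t.
  by rewrite -substoch_geometric summxE /series /= big_mkord.
apply: nondecreasing_is_cvgn.
  apply: nondecreasing_series => k _ _; exact: substoch_expr_ge0.
exists (\sum_r `|invmx (1%:M - Q) s r| * 2) => _ [k _ <-].
rewrite E mxE; apply: ler_sum => r _; apply: le_trans (ler_norm _) _.
rewrite normrM ler_wpM2l // !mxE; apply: le_trans (ler_normB _ _) _.
apply: lerD; first by case: (r == t); rewrite /= ?normr1 ?normr0.
by rewrite ger0_norm ?substoch_expr_ge0 // substoch_expr_le1.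
Qed.

(** Convergence of the series forces [Q^k] to tend to 0 in the closed form of its partial sums. *)
Lemma substoch_series_cvg s t :
  series (fun k => (Q ^+ k) s t) @ \oo --> invmx (1%:M - Q) s t.
Proof.
have E : series (fun k => (Q ^+ k) s t) =
    (fun k => \sum_r (invmx (1%:M - Q)) s r * ((r == t)%:R - (Q ^+ k) r t)).
  apply/funext => k; rewrite /series /= big_mkord -summxE substoch_geometric mxE.
  by apply: eq_bigr => r _; rewrite !mxE.
rewrite {}E.
have -> : invmx (1%:M - Q) s t =
    \sum_r (invmx (1%:M - Q)) s r * ((r == t)%:R - 0).
  under eq_bigr do rewrite subr0.
  rewrite (bigD1 t) //= eqxx mulr1 big1 ?addr0 // => r /negbTE ->.
  by rewrite mulr0.
apply: cvgn_sum => r; apply: cvgMr; apply: cvgB; first exact: cvg_cst.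
exact/cvg_series_cvg_0/substoch_series_is_cvg.
Qed.

Lemma substoch_inv_ge0 s t : 0 <= invmx (1%:M - Q) s t.
Proof.
apply: (cvgr_to_ge (@substoch_series_cvg s t)); apply: nearW => k.
by apply: sumr_ge0 => l _; exact: substoch_expr_ge0.
Qed.

(* Since [1 - Q] has a nonnegative inverse [1 + Q (1 - Q)^-1]. *)
Lemma substoch_ge_of_mul (d : 'cV[R]_n) :
  (forall s, 0 <= ((1%:M - Q) *m d) s 0) ->
  forall s, ((1%:M - Q) *m d) s 0 <= d s 0.
Proof.
move=> d_ge0 s.
have d0 t : 0 <= d t 0.
  rewrite -[d](mulKmx Q_unit) mxE sumr_ge0 // => r _.
  by rewrite mulr_ge0 // substoch_inv_ge0.
rewrite mulmxBl mul1mx !mxE gerBl sumr_ge0 // => t _; exact: mulr_ge0.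
Qed.

End Substochastic.

(* If [x Q = x] then [|x| <= |x| Q], and comparing total masses forces equality. *)
Lemma substoch_singular (R : realType) (n : nat) (Q : 'M[R]_n) :
  (forall s t, 0 <= Q s t) -> (forall s, \sum_t Q s t <= 1) ->
  1%:M - Q \notin unitmx ->
  exists y : 'rV[R]_n,
    [/\ forall s, 0 <= y 0 s, y != 0, y *m Q = y &
        forall s, y 0 s != 0 -> \sum_t Q s t = 1].
Proof.
move=> Q_ge0 Q_sum; rewrite -row_free_unit -kermx_eq0 => /rowV0Pn[x].
move=> /sub_kermxP; rewrite mulmxBr mulmx1 => /eqP; rewrite subr_eq0 => /eqP xQ x0.
pose y : 'rV[R]_n := \row_s `|x 0 s|.
have yE s : y 0 s = `|x 0 s| by rewrite mxE.
have y_ge0 s : 0 <= y 0 s by rewrite yE.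
have y_le t : y 0 t <= (y *m Q) 0 t.
  rewrite yE {1}xQ !mxE; apply: le_trans (ler_norm_sum _ _ _) _.
  by apply: ler_sum => s _; rewrite normrM yE (ger0_norm (Q_ge0 _ _)).
have mass : \sum_t (y *m Q) 0 t = \sum_s y 0 s * \sum_t Q s t.
  under eq_bigr do rewrite mxE.
  by rewrite exchange_big; apply: eq_bigr => s _; rewrite mulr_sumr.
have row_le s : y 0 s * \sum_t Q s t <= y 0 s by rewrite ler_piMr.
have massE : \sum_t (y *m Q) 0 t = \sum_t y 0 t.
  apply/eqP; rewrite eq_le; apply/andP; split; last exact: ler_sum.
  by rewrite mass; apply: ler_sum.
exists y; split => //.
- apply: contra x0 => /eqP y0; apply/eqP/rowP => s; rewrite [RHS]mxE.
  by apply/eqP; rewrite -normr_eq0 -yE y0 mxE.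
- apply/rowP => t; apply/eqP; rewrite -subr_eq0.
  have /psumr_eq0P -> // : \sum_t ((y *m Q) 0 t - y 0 t) = 0.
    by rewrite sumrB massE subrr.
  by move=> s _; rewrite subr_ge0.
(* Equal total masses also make each inequality [row_le] an equality. *)
- move=> s ys; have /eqP : y 0 s - y 0 s * \sum_t Q s t = 0.
    apply: (psumr_eq0P (P := predT) (F := fun s => y 0 s - y 0 s * \sum_t Q s t)) => //.
      by move=> r _; rewrite subr_ge0.
    by rewrite sumrB -mass massE subrr.
  by rewrite -{1}[y 0 s]mulr1 -mulrBr mulf_eq0 (negbTE ys) subr_eq0 => /eqP.
Qed.

(** * Occupation vectors of a policy and weak duality *)

Section Policies.
Variables (R : realType) (n m : nat) (I : ssp R n m).

Local Notation J := (ssp_J I).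
Local Notation P := (ssp_P I).
Local Notation c := (ssp_c I).

Lemma ssp_JE a s : J a s = (J a s == 1)%:R.
Proof. by case: (ssp_J01 I a s) => ->; rewrite ?eqxx // eq_sym oner_eq0. Qed.

Lemma ssp_J_inj a s t : J a s = 1 -> J a t = 1 -> s = t.
Proof. by case: (ssp_J_unique I a) => r [_ u] /u <- /u <-. Qed.

Lemma ssp_J_sum a s (g : 'I_n -> R) : J a s = 1 -> \sum_t J a t * g t = g s.
Proof.
move=> Jas; rewrite (bigD1 s) //= Jas mul1r big1 ?addr0 // => t ts.
rewrite ssp_JE; case: eqP => [Jat|_]; last by rewrite mul0r.
by rewrite (ssp_J_inj Jas Jat) eqxx in ts.
Qed.

Lemma ssp_J_ex a : exists s, J a s = 1.
Proof. by case: (ssp_J_unique I a) => r [? _]; exists r. Qed.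

Section OnePolicy.
Variable Pi : policy I.

(** Each action belongs to exactly one state, so the weights [J a s] keep the whole distribution
    [Pi h s'] if [s'] is [s], and none of it otherwise. *)
Lemma policy_sum_available h s s' :
  \sum_a J a s * Pi h s' (Some a) = (s' == Some s)%:R.
Proof.
case: eqP => [->|ne].
  rewrite -(policy_sum1 Pi h (Some s)) sum_option.
  have -> : Pi h (Some s) None = 0.
    by case: (eqVneq (Pi h (Some s) None) 0) => // /policy_available.
  rewrite add0r; apply: eq_bigr => a _.
  case: (eqVneq (Pi h (Some s) (Some a)) 0) => [->|]; first by rewrite mulr0.
  by move/policy_available => /= /eqP ->; rewrite mul1r.
apply: big1 => a _; apply/eqP; rewrite mulf_eq0.
case: (eqVneq (Pi h s' (Some a)) 0) => [|/policy_available]; rewrite (orbT, orbF)//.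
case: s' ne => //= t ne /eqP Jat; rewrite ssp_JE.
case: (J a s =P 1) => // Jas.
by case: ne; rewrite (ssp_J_inj Jas Jat).
Qed.

Section Initial.
Variable y0 : state n -> R.

Definition state_prob k s : R :=
  \sum_(h : k.-tuple (state n * action m)) history_prob Pi y0 h s.

Lemma state_prob0 s : state_prob 0 s = y0 s.
Proof. by rewrite /state_prob sum_tuple0. Qed.

Lemma action_prob_state k s :
  \sum_a J a s * action_prob Pi y0 k a 0 = state_prob k (Some s).
Proof.
under eq_bigr => a _ do rewrite mxE mulr_sumr.
rewrite exchange_big; apply: eq_bigr => h _.
under eq_bigr => a _ do rewrite mulr_sumr.
rewrite exchange_big (bigD1 (Some s)) //= [X in _ + X]big1 => [|s' /negbTE ne].
  under eq_bigr => a _ do rewrite mulrCA.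
  by rewrite -mulr_sumr policy_sum_available eqxx mulr1 addr0.
under eq_bigr => a _ do rewrite mulrCA.
by rewrite -mulr_sumr policy_sum_available ne mulr0.
Qed.

(** Together with [action_prob_state] this is conservation of flow, [J^T x_{k+1} = P^T x_k]. *)
Lemma state_probS k s :
  state_prob k.+1 (Some s) = \sum_a P a s * action_prob Pi y0 k a 0.
Proof.
rewrite /state_prob sum_tupleS.
under [RHS]eq_bigr => a _ do rewrite mxE mulr_sumr.
rewrite [RHS]exchange_big; apply: eq_bigr => h _.
under [RHS]eq_bigr => a _ do rewrite mulr_sumr.
rewrite [RHS]exchange_big /=.
transitivity (\sum_s' \sum_a
    history_prob Pi y0 h s' * Pi h s' a * trans I a (Some s)).
  by rewrite pair_bigA; apply: eq_bigr => -[s' a] _.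
apply: eq_bigr => s' _; rewrite sum_option /= mulr0 add0r.
by apply: eq_bigr => a _; rewrite mulrC.
Qed.

Hypothesis y0_ge0 : forall s, 0 <= y0 s.

Lemma trans_ge0 a s : 0 <= trans I a s.
Proof.
case: a s => [a|] [s|] //=; first exact: ssp_P_ge0.
by rewrite subr_ge0 ssp_P_substoch.
Qed.

Lemma history_prob_ge0 h s : 0 <= history_prob Pi y0 h s.
Proof.
elim: h s => [|[s' a] h IH] s //=.
by rewrite !mulr_ge0 ?trans_ge0 ?policy_ge0.
Qed.

Lemma action_prob_ge0 k a : 0 <= action_prob Pi y0 k a 0.
Proof.
rewrite mxE; apply: sumr_ge0 => h _; apply: sumr_ge0 => s _.
by rewrite mulr_ge0 ?history_prob_ge0 ?policy_ge0.
Qed.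

End Initial.

(* Reduced cost of [a] with respect to [V], as in linear programming. *)
Definition slack (V : 'cV[R]_n) a : R :=
  c a 0 + \sum_j P a j * V j 0 - \sum_s J a s * V s 0.

Lemma slackE V a s : J a s = 1 ->
  slack V a = c a 0 + \sum_j P a j * V j 0 - V s 0.
Proof. by move=> Jas; rewrite /slack (ssp_J_sum (fun t => V t 0) Jas). Qed.

(** Write [c] as [slack V + J V - P V]; the last two terms become state probabilities at times [k]
    and [k + 1]. *)
Lemma step_cost (V : 'cV[R]_n) y0 k :
  \sum_a c a 0 * action_prob Pi y0 k a 0 =
  \sum_s (state_prob y0 k (Some s) - state_prob y0 k.+1 (Some s)) * V s 0 +
  \sum_a slack V a * action_prob Pi y0 k a 0.
Proof.
under [X in _ = X + _]eq_bigr => s _.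
  rewrite -action_prob_state state_probS -sumrB mulr_suml; over.
rewrite exchange_big -big_split; apply: eq_bigr => a _ /=.
rewrite /slack mulrBl mulrDl.
have -> : \sum_s (J a s * action_prob Pi y0 k a 0 -
               P a s * action_prob Pi y0 k a 0) * V s 0 =
  (\sum_s J a s * V s 0) * action_prob Pi y0 k a 0 -
  (\sum_s P a s * V s 0) * action_prob Pi y0 k a 0.
  rewrite !mulr_suml -sumrB; apply: eq_bigr => s _.
  ring.
by rewrite addrC addrA subrK addrK.
Qed.

(** Summing [step_cost] over [k < K] makes the state probabilities telescope. *)
Lemma partial_cost (V : 'cV[R]_n) i K :
  \sum_a c a 0 * series (fun k => action_prob Pi (point_mass R i) k a 0) K =
  V i 0 - \sum_s state_prob (point_mass R i) K (Some s) * V s 0 +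
  \sum_a slack V a * series (fun k => action_prob Pi (point_mass R i) k a 0) K.
Proof.
elim: K => [|K IH].
  rewrite /series /=; under eq_bigr do rewrite big_geq // mulr0.
  under [X in _ = _ + X]eq_bigr do rewrite big_geq // mulr0.
  rewrite !big1_eq addr0 (bigD1 i) //= state_prob0 /point_mass eqxx mul1r.
  rewrite big1 ?addr0 ?subrr // => s si.
  by rewrite state_prob0 (inj_eq Some_inj) (negbTE si) mul0r.
under eq_bigr do rewrite seriesSr mulrDr.
under [X in _ = _ + X]eq_bigr do rewrite seriesSr mulrDr.
rewrite !big_split /= IH (step_cost V).
under [X in _ + (X + _)]eq_bigr do rewrite mulrBl.
rewrite sumrB [LHS]addrACA; congr (_ + _).
by rewrite addrA subrK.
Qed.

Lemma state_prob_cvg0 i s : proper_from Pi i ->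
  (fun k => state_prob (point_mass R i) k (Some s)) @ \oo --> (0 : R).
Proof.
move=> prop; have -> : (0 : R) = \sum_a J a s * 0.
  by rewrite big1 // => a _; rewrite mulr0.
rewrite (_ : (fun k => _) = fun k =>
    \sum_a J a s * action_prob Pi (point_mass R i) k a 0).
  apply: cvgn_sum => a; apply: cvgMr; apply: cvg_series_cvg_0; exact: prop.
by apply/funext => k; rewrite action_prob_state.
Qed.

(** In the limit of [partial_cost] the boundary term at time [K] vanishes, since the mass outside
    the target tends to 0. *)
Lemma policy_costE (V : 'cV[R]_n) i : proper_from Pi i ->
  policy_cost Pi i = V i 0 + \sum_a slack V a *
    limn (series (fun k => action_prob Pi (point_mass R i) k a 0)).
Proof.
move=> prop; rewrite /policy_cost mxE.
under eq_bigr do rewrite [_^T _ _]mxE [X in _ * X]mxE.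
pose X a := series (fun k => action_prob Pi (point_mass R i) k a 0).
have XL (b : 'I_m -> R) :
    (fun K => \sum_a b a * X a K) @ \oo --> \sum_a b a * limn (X a).
  by apply: cvgn_sum => a; apply: cvgMr; exact: prop.
apply: (cvg_unique _ (XL (fun a => c a 0))) => //.
rewrite (funext (partial_cost V i)).
apply: cvgD (XL _).
rewrite -{2}[V i 0]subr0; apply: cvgB; first exact: cvg_cst.
rewrite [X in _ --> X](_ : 0 = \sum_s 0 * V s 0); last first.
  by rewrite big1 // => s _; rewrite mul0r.
apply: cvgn_sum => s.
by apply: cvgMl; exact: state_prob_cvg0.
Qed.

Lemma point_mass_ge0 i (s : state n) : 0 <= point_mass R i s.
Proof. exact: ler0n. Qed.

(* Weak linear programming duality. *)
Lemma feasible_le_policy_cost (V : 'cV[R]_n) i :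
  (forall a, 0 <= slack V a) -> proper_from Pi i -> V i 0 <= policy_cost Pi i.
Proof.
move=> sl prop; rewrite (policy_costE V) // lerDl; apply: sumr_ge0 => a _.
rewrite mulr_ge0 //; apply: limr_ge; first exact: prop.
apply: nearW => K; apply: sumr_ge0 => k _; apply: action_prob_ge0.
exact: point_mass_ge0.
Qed.

End OnePolicy.
End Policies.

(** * Deterministic stationary policies and policy improvement *)

Section Stationary.
Variables (R : realType) (n m : nat) (I : ssp R n m).

Local Notation J := (ssp_J I).
Local Notation P := (ssp_P I).
Local Notation c := (ssp_c I).

Implicit Type f : {ffun 'I_n -> 'I_m}.

Definition stationary_mx f : 'M[R]_n := \matrix_(s, t) P (f s) t.
Definition stationary_cost f : 'cV[R]_n := \col_s c (f s) 0.
(** For invertible [1 - P_f] this is the solution of [V = c_f + P_f V]; on a singular matrix [invmx]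
    returns its argument, and the value has no meaning. *)
Definition stationary_value f : 'cV[R]_n :=
  invmx (1%:M - stationary_mx f) *m stationary_cost f.

Definition selector f := [forall s, J (f s) s == 1].
(** Invertibility is a decidable algebraic stand-in for properness, which [stationary_proper]
    derives from it. *)
Definition proper_selector f := selector f && (1%:M - stationary_mx f \in unitmx).

Lemma selectorP f s : selector f -> J (f s) s = 1.
Proof. by move=> /forallP/(_ s)/eqP. Qed.

Lemma stationary_mx_ge0 f s t : 0 <= stationary_mx f s t.
Proof. by rewrite mxE ssp_P_ge0. Qed.

Lemma stationary_mx_sum f s : \sum_t stationary_mx f s t <= 1.
Proof. by under eq_bigr do rewrite mxE; exact: ssp_P_substoch. Qed.

Lemma slack_selector f (V : 'cV[R]_n) s : selector f ->
  slack I V (f s) = (stationary_cost f - (1%:M - stationary_mx f) *m V) s 0.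
Proof.
move=> sel; rewrite (slackE _ (selectorP s sel)) mulmxBl mul1mx !mxE.
by under [X in _ = _ - (_ - X)]eq_bigr do rewrite mxE; rewrite opprB addrA.
Qed.

Lemma slack_stationary_value f s : proper_selector f ->
  slack I (stationary_value f) (f s) = 0.
Proof.
by case/andP=> sel un; rewrite slack_selector // mulKVmx // subrr mxE.
Qed.

(** For [d = V_f - V_g], the vector [(1 - P_g) d] is minus the slack of [V_f] along [g], hence
    nonnegative and a lower bound for [d]. *)
Lemma stationary_value_improve f g : proper_selector f -> proper_selector g ->
  (forall s, slack I (stationary_value f) (g s) <= 0) ->
  forall s, stationary_value g s 0 <=
            stationary_value f s 0 + slack I (stationary_value f) (g s).
Proof.
move=> /andP[self unf] /andP[selg ung] sl s.
pose d := stationary_value f - stationary_value g.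
have dE t : ((1%:M - stationary_mx g) *m d) t 0 =
    - slack I (stationary_value f) (g t).
  rewrite slack_selector // /d mulmxBr [_ *m stationary_value g]mulKVmx //.
  by rewrite -opprB [LHS]mxE.
have d_ge0 t : 0 <= ((1%:M - stationary_mx g) *m d) t 0 by rewrite dE oppr_ge0.
have := substoch_ge_of_mul (stationary_mx_ge0 g) (@stationary_mx_sum g) ung d_ge0 s.
rewrite dE.
rewrite [d s 0]mxE [(- _ : 'cV_n) s 0]mxE; lra.
Qed.

Lemma switch_unitmx f g i : no_negative_transition_cycle I ->
  proper_selector f -> selector g -> (forall s, s != i -> g s = f s) ->
  slack I (stationary_value f) (g i) < 0 ->
  1%:M - stationary_mx g \in unitmx.
Proof.
move=> noneg pf selg gf sl; have /andP[self unf] := pf; apply/negP => /negP nun.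
have [y [y_ge0 y0 yQ _]] :=
  substoch_singular (stationary_mx_ge0 g) (stationary_mx_sum g) nun.
(* Otherwise [y] would be invariant under [P_f] too, whose rows agree with those of [P_g] off
   [i]. *)
have yi : 0 < y 0 i.
  rewrite lt_def y_ge0 andbT; apply: contra y0 => /eqP yi0.
  have yQf : y *m stationary_mx f = y.
    rewrite -[RHS]yQ; apply/rowP => t; rewrite !mxE; apply: eq_bigr => s _.
    by have [->|si] := eqVneq s i; rewrite ?yi0 ?mul0r // !mxE gf.
  by rewrite -[y](mulmxK unf) mulmxBr mulmx1 yQf subrr mul0mx.
(* Push [y] forward along [g]: the mass of [s] goes to the action [g s]. *)
pose x : 'cV[R]_m := \col_a \sum_s (g s == a)%:R * y 0 s.
have xE (b : 'I_m -> R) : \sum_a b a * x a 0 = \sum_s b (g s) * y 0 s.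
  under eq_bigr => a _ do rewrite mxE mulr_sumr.
  rewrite exchange_big; apply: eq_bigr => s _.
  rewrite (bigD1 (g s)) //= eqxx mul1r big1 ?addr0 // => a.
  by rewrite eq_sym => /negbTE ->; rewrite mul0r mulr0.
(* For a selector, [J] restricted to the chosen actions is the identity, so this restates
   [y P_g = y]. *)
have flow t : \sum_s (J (g s) t - P (g s) t) * y 0 s = 0.
  under eq_bigr do rewrite mulrBl; rewrite sumrB; apply/eqP; rewrite subr_eq0.
  apply/eqP; transitivity (y 0 t).
    rewrite (bigD1 t) //= selectorP // mul1r big1 ?addr0 // => s st.
    rewrite ssp_JE; case: eqP => [Jgs|_]; last by rewrite mul0r.
    by rewrite (ssp_J_inj Jgs (selectorP s selg)) eqxx in st.
  rewrite -{1}yQ mxE; by apply: eq_bigr => s _; rewrite mxE mulrC.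
apply: noneg; exists x; split.
- by move=> a; rewrite mxE sumr_ge0 // => s _; rewrite mulr_ge0 ?ler0n.
- apply/colP => t; rewrite [RHS]mxE -[RHS](flow t) -(xE (fun a => J a t - P a t)).
  by rewrite mxE; apply: eq_bigr => a _; rewrite !mxE.
pose V := stationary_value f.
suff -> : (c^T *m x) 0 0 = slack I V (g i) * y 0 i by rewrite pmulr_llt0.
(* By [flow] the terms [J V - P V] contribute nothing, so costs may be replaced by slacks, which
   vanish off [i]. *)
have -> : (c^T *m x) 0 0 = \sum_s slack I V (g s) * y 0 s.
  rewrite mxE; under eq_bigr do rewrite [_^T _ _]mxE.
  rewrite xE; apply/eqP; rewrite -subr_eq0 -sumrB.
  under eq_bigr => s _.
    have -> : c (g s) 0 * y 0 s - slack I V (g s) * y 0 s =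
        \sum_t V t 0 * ((J (g s) t - P (g s) t) * y 0 s).
      rewrite /slack; under [RHS]eq_bigr do rewrite mulrA mulrBr.
      rewrite -mulr_suml sumrB; under [X in _ = (X - _) * _]eq_bigr do rewrite mulrC.
      under [X in _ = (_ - X) * _]eq_bigr do rewrite mulrC.
      ring.
    over.
  rewrite exchange_big big1 // => t _.
  by rewrite -mulr_sumr flow mulr0.
rewrite (bigD1 i) //= big1 ?addr0 // => s si.
by rewrite gf // slack_stationary_value // mul0r.
Qed.

Lemma exists_feasible_value f0 : no_negative_transition_cycle I ->
  proper_selector f0 ->
  exists2 f, proper_selector f & forall a, 0 <= slack I (stationary_value f) a.
Proof.
move=> noneg pf0.
(* There are finitely many selectors; the sum of entries detects a strict decrease at a single
   state. *)
have := arg_minP (fun f => \sum_s stationary_value f s 0) pf0.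
case=> f pf fmin; exists f => // a; rewrite leNgt; apply/negP => sl.
have [i Jai] := ssp_J_ex I a.
pose g : {ffun 'I_n -> 'I_m} := [ffun s => if s == i then a else f s].
have gi : g i = a by rewrite ffunE eqxx.
have gf s : s != i -> g s = f s by rewrite ffunE => /negbTE ->.
have selg : selector g.
  apply/forallP => s; have [->|si] := eqVneq s i; first by rewrite gi Jai.
  by rewrite gf // selectorP //; case/andP: pf.
have pg : proper_selector g.
  by rewrite /proper_selector selg (@switch_unitmx f _ i) // gi.
have slg s : slack I (stationary_value f) (g s) <= 0.
  have [->|si] := eqVneq s i; first by rewrite gi ltW.
  by rewrite gf // slack_stationary_value.
have := fmin g pg; apply/negP; rewrite -ltNge.
have le_gf := stationary_value_improve pf pg slg.
rewrite (bigD1 i) //= [X in _ < X](bigD1 i) //=; apply: ltr_leD.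
  by apply: le_lt_trans (le_gf i) _; rewrite gi gtrDl.
by apply: ler_sum => s _; apply: le_trans (le_gf s) _; rewrite gerDl.
Qed.

(* Each state plays the first action of a shortest path to the target; a closed
   set of states avoiding the target would contain a state nearest to it. *)
Lemma exists_proper_selector : target_reachable I -> exists f, proper_selector f.
Proof.
move=> reach.
pose len (s : state n) k := [exists t : k.-tuple (state n + action m),
  path (support_arc I) (inl s) t && (last (inl s) t == inl None)].
have len_ex s : exists k, len s k.
  have /connectP[p pp pl] := reach s; exists (size p).
  by apply/existsP; exists (in_tuple p); rewrite /= pp -pl eqxx.
pose d s := ex_minn (len_ex s).
have step s : exists a, J a s = 1 /\
    exists2 t, 0 < trans I (Some a) t & (d t < d (Some s))%N.
  (* A shortest path starts with an action [a] and a state [t]; its remainder is a path from [t],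
     shorter by two arcs. *)
  rewrite {2}/d; case: ex_minnP => k /existsP[[p /= /eqP sp]] /andP[pp pl] _.
  case: p pp pl sp => [|[s'|[a|]] [|[t|a'] p]] //=; rewrite ?andbF //.
  case/and3P=> /eqP Jas ta pp pl sp.
  exists a; split => //; exists t => //; rewrite /d; case: ex_minnP => l _ lmin.
  rewrite -sp ltnS; apply: leq_trans (lmin (size p) _) (leqnSn _).
  by apply/existsP; exists (in_tuple p); rewrite /= pp.
have [f0 f0P] := choice step.
pose f : {ffun 'I_n -> 'I_m} := [ffun s => f0 s].
have fE s : f s = f0 s by rewrite ffunE.
exists f; apply/andP; split.
  by apply/forallP => s; rewrite fE; case: (f0P s) => ->.
apply/negP => /negP nun.
have [y [y_ge0 y0 yQ ysum]] :=
  substoch_singular (stationary_mx_ge0 f) (stationary_mx_sum f) nun.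
have [i yi] : exists i, y 0 i != 0.
  apply/existsP; rewrite -negb_forall; apply: contra y0 => /forallP y0.
  by apply/eqP/rowP => s; rewrite [RHS]mxE; apply/eqP.
have [s ys smin] := @arg_minnP _ i (fun s => y 0 s != 0) (fun s => d (Some s)) yi.
have [_ [t]] := f0P s; rewrite -fE; case: t => [t|] /= ft lt.
  (* Invariance carries mass from [s] to [t], so the nearer state [t] would lie in the support of
     [y]. *)
  suff /smin : y 0 t != 0 by rewrite leqNgt lt.
  rewrite gt_eqF // -yQ mxE (bigD1 s) //=; apply: ltr_pwDl.
    by rewrite mxE mulr_gt0 // lt_def ys y_ge0.
  by apply: sumr_ge0 => r _; rewrite mulr_ge0 ?stationary_mx_ge0.
(* Here the target is reached directly, whereas rows in the support of [y] sum to 1. *)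
have := ysum s ys; under eq_bigr do rewrite mxE.
by move=> E; rewrite E subrr ltxx in ft.
Qed.

(** * The policy of a proper selector and its cost *)

Section StationaryPolicy.
Variable f : {ffun 'I_n -> 'I_m}.
Hypothesis f_proper : proper_selector f.

Let sel : selector f. Proof. by case/andP: f_proper. Qed.

Definition stationary_fun (h : history n m) (s : state n) (a : action m) : R :=
  (omap f s == a)%:R.

Lemma stationary_ge0 h s a : 0 <= stationary_fun h s a.
Proof. exact: ler0n. Qed.

Lemma stationary_sum1 h s : \sum_a stationary_fun h s a = 1.
Proof.
rewrite /stationary_fun (bigD1 (omap f s)) //= eqxx big1 ?addr0 // => a.
by rewrite eq_sym => /negbTE ->.
Qed.

Lemma stationary_available h s a : stationary_fun h s a != 0 -> available I s a.
Proof.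
rewrite /stationary_fun; case: (omap f s =P a) => [<-|_]; last by rewrite eqxx.
by case: s => //= s _; rewrite selectorP.
Qed.

Definition stationary_policy : policy I :=
  Policy stationary_ge0 stationary_sum1 stationary_available.

Lemma stationary_action_prob y0 k a :
  action_prob stationary_policy y0 k a 0 =
  \sum_s (f s == a)%:R * state_prob stationary_policy y0 k (Some s).
Proof.
rewrite mxE; under [RHS]eq_bigr do rewrite mulr_sumr.
rewrite [RHS]exchange_big; apply: eq_bigr => h _.
rewrite sum_option /= /stationary_fun /= mulr0 add0r.
by apply: eq_bigr => s _; rewrite mulrC (inj_eq Some_inj).
Qed.

Lemma stationary_state_prob i k s :
  state_prob stationary_policy (point_mass R i) k (Some s) =
  (stationary_mx f ^+ k) i s.
Proof.
elim: k s => [|k IH] s.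
  by rewrite state_prob0 expr0 mxE /point_mass (inj_eq Some_inj) eq_sym.
rewrite state_probS exprSr mxE.
under eq_bigr => a _ do rewrite stationary_action_prob mulr_sumr.
rewrite exchange_big; apply: eq_bigr => r _.
rewrite (bigD1 (f r)) //= eqxx mul1r big1 => [|a].
  by rewrite addr0 IH !mxE mulrC.
by rewrite eq_sym => /negbTE ->; rewrite mul0r mulr0.
Qed.

(** The expected number of visits to [s] from [i] is the entry of the sum of the powers of [P_f]. *)
Lemma stationary_series_cvg i a :
  series (fun k => action_prob stationary_policy (point_mass R i) k a 0) @ \oo -->
  \sum_s (f s == a)%:R * invmx (1%:M - stationary_mx f) i s.
Proof.
rewrite (_ : series _ = fun K => \sum_s (f s == a)%:R *
    series (fun k => (stationary_mx f ^+ k) i s) K).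
  apply: cvgn_sum => s; apply: cvgMr; apply: substoch_series_cvg.
  - exact: stationary_mx_ge0.
  - exact: stationary_mx_sum.
  - by case/andP: f_proper.
apply/funext => K; rewrite /series /=.
under eq_bigr do rewrite stationary_action_prob.
rewrite exchange_big; apply: eq_bigr => s _; rewrite mulr_sumr.
by apply: eq_bigr => k _; rewrite stationary_state_prob.
Qed.

Lemma stationary_proper : Defs.proper stationary_policy.
Proof. by move=> i a; apply/cvg_ex; eexists; exact: stationary_series_cvg. Qed.

(** Complementary slackness: actions chosen by [f] have slack 0, all others are never taken. *)
Lemma stationary_policy_cost i :
  policy_cost stationary_policy i = stationary_value f i 0.
Proof.
rewrite (policy_costE (stationary_value f)); last exact: stationary_proper.
rewrite big1 ?addr0 // => a _; rewrite (cvg_lim _ (@stationary_series_cvg i a)) //.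
rewrite mulr_sumr big1 // => s _.
case: eqP => [<-|_]; last by rewrite mul0r mulr0.
by rewrite slack_stationary_value // mul0r.
Qed.

End StationaryPolicy.
End Stationary.

(** * Monotone convergence of value iteration *)

Section ValueIteration.
Variables (R : realType) (n m : nat) (I : ssp R n m).
Implicit Types V W M : 'cV[R]_n.

Local Notation J := (ssp_J I).
Local Notation P := (ssp_P I).
Local Notation c := (ssp_c I).

Lemma vi_step_le V i : vi_step I V i 0 <= V i 0.
Proof. by rewrite mxE; exact: bigmin_le_id. Qed.

Lemma vi_step_le_action V a i : J a i = 1 ->
  vi_step I V i 0 <= c a 0 + \sum_j P a j * V j 0.
Proof. by move=> Jai; rewrite mxE; apply: bigmin_le_cond; rewrite Jai. Qed.

(** Feasibility bounds [V] by its own one-step values, and these are monotone because [P] is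
    nonnegative. *)
Lemma feasible_le_vi_step V W : (forall a, 0 <= slack I V a) ->
  (forall i, V i 0 <= W i 0) -> forall i, V i 0 <= vi_step I W i 0.
Proof.
move=> sl VW i; rewrite mxE; apply: le_bigmin => // a /eqP Jai.
have := sl a; rewrite (slackE _ Jai) subr_ge0 => /le_trans; apply.
by rewrite lerD2l; apply: ler_sum => j _; rewrite ler_wpM2l ?ssp_P_ge0.
Qed.

Lemma feasible_le_vi_iter V M : (forall a, 0 <= slack I V a) ->
  (forall i, V i 0 <= M i 0) ->
  forall k i, V i 0 <= iter k (vi_step I) M i 0.
Proof. by move=> sl VM; elim=> [|k IH] //= i; exact: feasible_le_vi_step. Qed.

(** The iterates decrease and are bounded below by [V]; the inequality [vi_step_le_action] between
    consecutive iterates passes to the limit. *)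
Lemma vi_iter_cvg V M : (forall a, 0 <= slack I V a) ->
  (forall i, V i 0 <= M i 0) ->
  exists2 L : 'cV[R]_n, forall a, 0 <= slack I L a &
    forall i, (fun k => iter k (vi_step I) M i 0) @ \oo --> L i 0.
Proof.
move=> sl VM; pose u i k := iter k (vi_step I) M i 0.
have ucvg i : cvgn (u i).
  apply: nonincreasing_is_cvgn.
    by apply/nonincreasing_seqP => k; exact: vi_step_le.
  by exists (V i 0) => _ [k _ <-]; exact: feasible_le_vi_iter.
exists (\col_i limn (u i)) => [a|i]; last by rewrite mxE; exact: ucvg.
have [i Jai] := ssp_J_ex I a.
rewrite (slackE _ Jai) mxE subr_ge0.
under eq_bigr do rewrite mxE.
have rhs : (fun k => c a 0 + \sum_j P a j * u j k) @ \oo -->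
    c a 0 + \sum_j P a j * limn (u j).
  apply: cvgD; first exact: cvg_cst.
  by apply: cvgn_sum => j; apply: cvgMr; exact: ucvg.
have lhs : (fun k => u i k.+1) @ \oo --> limn (u i).
  by rewrite (cvg_shiftS (u i)); exact: ucvg.
by apply: (ler_cvg_to lhs rhs); apply: nearW => k; exact: vi_step_le_action.
Qed.

End ValueIteration.

(** * Attainment of the minimum and convergence to it *)

Unset Implicit Arguments.

Theorem theorem3 (R : realType) (n m : nat) (I : ssp R n m) (M : 'cV[R]_n)
    (reach : target_reachable I)
    (noneg : no_negative_transition_cycle I)
    (hM : forall i : 'I_n, Vstar I i <= M i 0) :
  forall i : 'I_n,
    is_minimum (proper_costs I i) (Vstar I i) /\
    (fun K : nat => value_iteration I M K i 0) @ \oo --> Vstar I i.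
Proof.
have [f0 pf0] := exists_proper_selector reach.
have [f pf sl] := exists_feasible_value noneg pf0.
pose V := stationary_value I f.
have min_cost i : is_minimum (proper_costs I i) (V i 0).
  split; first by exists (stationary_policy pf);
    [exact: stationary_proper|exact: stationary_policy_cost].
  by move=> _ [Pi prop <-]; apply: feasible_le_policy_cost => //; exact: prop.
have VstarE i : Vstar I i = V i 0.
  have [Vin Vlb] := min_cost i; apply/eqP; rewrite eq_le; apply/andP; split.
    by apply: ge_inf => //; exists (V i 0).
  by apply: lb_le_inf => //; exists (V i 0).
have VM i : V i 0 <= M i 0 by rewrite -VstarE.
have [L slL cvgL] := vi_iter_cvg sl VM.
move=> i; rewrite VstarE; split; first exact: min_cost.
(* [value_iteration] starts at index 1, so shifting by one gives the plain iterates. *)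
suff <- : L i 0 = V i 0 by rewrite -cvg_shiftS; exact: cvgL.
apply/eqP; rewrite eq_le; apply/andP; split.
  (* The limit [L] is dual feasible, so weak duality puts it below the cost of the policy of [f]. *)
  rewrite -(stationary_policy_cost pf); apply: feasible_le_policy_cost => //.
  exact: stationary_proper.
apply: (cvgr_to_ge (cvgL i)); apply: nearW => k.
exact: feasible_le_vi_iter.
Qed.
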